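(* Let $X$ be an infinite-dimensional real Banach space. The following statements are equivalent. (a) $X^*$ fails the Schur property. (b) There is a bounded $wc_0^*$-biorthogonal system in $X\times X^*$. If moreover $X$ is separable, then (a) and (b) are also equivalent to: (c) There is a bounded fundamental total $wc_0^*$-biorthogonal system $\{x_n, x_n^*\}_{n=1}^\infty$ in $X\times X^*$. Furthermore, for each $\varepsilon>0$: if (b) holds, then the system in (b) can be taken to be $(1+\varepsilon)$-bounded; if ($X$ is separable and) (c) holds, then the system in (c) can be taken to be $[2(1+\sqrt2)^2+\varepsilon]$-bounded and so that the closed linear span $[x_n^*]$ norms $X$.
   Context: All Banach spaces are real and infinite-dimensional. A Banach space has the Schur property if every weakly convergent sequence in it is norm convergent. $[A]$ denotes the closed linear span of $A$. A sequence of pairs $\{x_n,x_n^*\}_{n=1}^\infty$ in $X\times X^*$ is a biorthogonal system if $x_n^*(x_m)=\delta_{nm}$. It is $M$-bounded if $\{x_n\}$ and $\{x_n^*\}$ are bounded and $\sup_n\|x_n\|\,\|x_n^*\|\le M$; bounded if it is $M$-bounded for some finite $M$; fundamental if $[x_n]_{n}=X$; total if the weak$^*$-closure of the linear span of $\{x_n^*\}$ is $X^*$ (equivalently, $x_n^*(x)=0$ for all $n$ implies $x=0$). A biorthogonal system $\{x_n,x_n^*\}$ in $X\times X^*$ is a $wc_0^*$-biorthogonal system if $\{x_n^*\}$ is a semi-normalized (bounded and bounded away from zero in norm) weakly null sequence in $X^*$. For $\tau\ge1$, a subset $Z\subset X^*$ $\tau$-norms $X$ if $\|x\|\le\tau\sup_{z\in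 Z\setminus\{0\}} z(x)/\|z\|$ for each $x\in X$; $Z$ norms $X$ if it $1$-norms $X$. *)

(* Defs.v *)
From HB Require Import structures.
From mathcomp Require Import all_boot all_order all_algebra.
From mathcomp Require Import all_classical all_reals all_analysis.

Set Implicit Arguments.
Unset Strict Implicit.
Unset Printing Implicit Defensive.

Import Order.TTheory GRing.Theory Num.Theory.
Import numFieldNormedType.Exports.

Local Open Scope classical_set_scope.
Local Open Scope ring_scope.

(* The continuous dual E^* is a subtype of the pointwise module E -> R, made a
   normed module by the operator norm; the bidual is [dual (dual E)]. *)
Definition dual_pred (R : realType) (E : normedModType R) : {pred E -> R} :=
  fun f => `[< linear f /\ continuous f >].

Lemma dual_pred_submod_closed (R : realType) (E : normedModType R) :
  submod_closed (@dual_pred R E).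
Proof.
split=> [|a f g /asboolP[lf cf] /asboolP[lg cg]]; apply/asboolP; split.
- by move=> k x y /=; rewrite scaler0 addr0.
- by move=> x; exact: cvg_cst.
- move=> k x y; rewrite !fctE lf lg !scalerDr !scalerA mulrC.
  by rewrite -!addrA; congr (_ + _); rewrite addrCA.
- by move=> x; apply: cvgD; [apply: cvgZl_tmp; exact: cf|exact: cg].
Qed.

HB.instance Definition _ (R : realType) (E : normedModType R) :=
  GRing.isSubmodClosed.Build R (E -> R) (@dual_pred R E)
    (@dual_pred_submod_closed R E).

Record dual (R : realType) (E : normedModType R) := Dual {
  dual_fun :> E -> R ;
  dual_funP : dual_pred dual_fun }.

HB.instance Definition _ (R : realType) (E : normedModType R) :=
  [isSub for @dual_fun R E].
HB.instance Definition _ (R : realType) (E : normedModType R) :=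
  [Choice of dual E by <:].
HB.instance Definition _ (R : realType) (E : normedModType R) :=
  [SubChoice_isSubLmodule of dual E by <:].

Section DualNorm.
Variables (R : realType) (E : normedModType R).
Implicit Types (f g : dual E).

Definition dual_norm f : R := sup [set `|f x| | x in [set x : E | `|x| <= 1]].

Lemma dual_linear f : linear f.
Proof. by case: f => f /= /asboolP[]. Qed.

Lemma dual_continuous f : continuous f.
Proof. by case: f => f /= /asboolP[]. Qed.

HB.instance Definition _ f := GRing.isLinear.Build R E R *:%R f (dual_linear f).

Lemma dual_norm_has_sup f :
  has_sup [set `|f x| | x in [set x : E | `|x| <= 1]].
Proof.
split; first by exists `|f 0|, 0 => //=; rewrite normr0 ler01.
have /linear_bounded_continuous/bounded_funP/(_ 1)[M fM] := dual_continuous (f := f).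
by exists M => _ [x /= x1 <-]; exact: fM.
Qed.

Lemma dual_norm_ub f x : `|x| <= 1 -> `|f x| <= dual_norm f.
Proof.
by move=> x1; apply: (ub_le_sup (dual_norm_has_sup f).2); exists x.
Qed.

Lemma dual_norm_ge0 f : 0 <= dual_norm f.
Proof. by apply: le_trans (@dual_norm_ub f 0 _) => //; rewrite normr0. Qed.

Lemma dual_norm_le f M :
  (forall x, `|x| <= 1 -> `|f x| <= M) -> dual_norm f <= M.
Proof.
move=> fM; apply: ge_sup; first exact: (dual_norm_has_sup f).1.
by move=> _ [x x1 <-]; exact: fM.
Qed.

Lemma dual_normP f x : `|f x| <= dual_norm f * `|x|.
Proof.
have [->|x0] := eqVneq x 0; first by rewrite linear0 !normr0 mulr0.
have nx : 0 < `|x| by rewrite normr_gt0.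
rewrite -ler_pdivrMr//; apply: le_trans (@dual_norm_ub f (`|x|^-1 *: x) _).
  by rewrite linearZ normrZ ger0_norm ?invr_ge0// mulrC.
by rewrite normrZ ger0_norm ?invr_ge0// mulVf ?gt_eqF.
Qed.

Lemma dual_normD f g : dual_norm (f + g) <= dual_norm f + dual_norm g.
Proof.
apply: dual_norm_le => x x1.
by rewrite (le_trans (ler_normD _ _))// lerD// dual_norm_ub.
Qed.

Lemma dual_normZ_le (a : R) f : dual_norm (a *: f) <= `|a| * dual_norm f.
Proof.
apply: dual_norm_le => x x1; change (`|a * f x| <= `|a| * dual_norm f).
by rewrite normrM ler_wpM2l// dual_norm_ub.
Qed.

Lemma dual_normZ (a : R) f : dual_norm (a *: f) = `|a| * dual_norm f.
Proof.
apply/eqP; rewrite eq_le dual_normZ_le/=.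
have [->|a0] := eqVneq a 0; first by rewrite normr0 mul0r dual_norm_ge0.
have na : 0 < `|a| by rewrite normr_gt0.
rewrite -ler_pdivlMl// -normfV.
by rewrite -[X in dual_norm X <= _](scalerK a0) dual_normZ_le.
Qed.

Lemma dual_norm_eq0 f : dual_norm f = 0 -> f = 0.
Proof.
move=> f0; apply: val_inj; apply/funext => x.
by apply/eqP; rewrite -normr_le0 (le_trans (dual_normP f x))// f0 mul0r.
Qed.

HB.instance Definition _ :=
  Lmodule_isNormed.Build R (dual E) dual_normD dual_normZ dual_norm_eq0.

End DualNorm.


(* E with the weak topology sigma(E, E^* ). *)
Definition weak (R : realType) (E : normedModType R) : Type :=
  initial_topology ((fun x f => f x) : E -> {ptws dual E -> R}).

HB.instance Definition _ (R : realType) (E : normedModType R) :=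
  Uniform.copy (weak E)
    (initial_topology ((fun x f => f x) : E -> {ptws dual E -> R})).

(* E^* with the weak* topology sigma(E^*, E). *)
Definition weak_star (R : realType) (E : normedModType R) : Type :=
  initial_topology (@dual_fun R E : dual E -> {ptws E -> R}).

HB.instance Definition _ (R : realType) (E : normedModType R) :=
  Uniform.copy (weak_star E)
    (initial_topology (@dual_fun R E : dual E -> {ptws E -> R})).

Section BanachNotions.
Variables (R : realType) (E : normedModType R).

Definition weakly_cvg (u : nat -> E) (x : E) : Prop :=
  (u : nat -> weak E) @ \oo --> (x : weak E).

Lemma weakly_cvgP (u : nat -> E) (x : E) :
  weakly_cvg u x <-> forall f : dual E, f (u n) @[n --> \oo] --> f x.
Proof.
pose ev := (fun x f => f x) : E -> {ptws dual E -> R}.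
have -> : (forall f : dual E, f (u n) @[n --> \oo] --> f x) <->
  {ptws, (ev \o u) @ \oo --> ev x}.
  by split => [H|/pointwise_cvgP]; [apply/pointwise_cvgP|].
split => [H|H].
  by have := cvg_comp _ _ H (@initial_continuous _ _ ev x).
move=> A [_ [[B oB <-] Bx BA]].
have HB : ((ev \o u) @ \oo) B by apply: H; exact: open_nbhs_nbhs.
exact: (@filterS _ _ _ _ _ (fun n Bn => BA (u n) Bn) HB).
Qed.

Definition schur_property : Prop :=
  forall (u : nat -> E) (x : E), weakly_cvg u x -> cvgn u.

Definition lin_span (A : set E) : set E :=
  [set x | exists (n : nat) (a : 'I_n -> R) (v : 'I_n -> E),
     (forall i, A (v i)) /\ x = \sum_i a i *: v i].

Definition closed_span (A : set E) : set E := closure (lin_span A).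

Definition infinite_dimensional : Prop :=
  forall (n : nat) (v : 'I_n -> E), lin_span (range v) <> setT.

Definition separable : Prop :=
  exists D : set E, countable D /\ dense D.

(* Each quotient is at most `|x|, so the real-valued [sup] is the true one as soon
   as Z contains a nonzero functional; otherwise [sup set0 = 0]. *)
Definition tau_norms (tau : R) (Z : set (dual E)) : Prop :=
  forall x : E, `|x| <= tau * sup [set z x / `|z| | z in Z `\ 0].

Definition norms (Z : set (dual E)) : Prop := tau_norms 1 Z.

End BanachNotions.

Section Biorthogonal.
Variables (R : realType) (X : normedModType R).
Implicit Types (x : nat -> X) (xs : nat -> dual X).

Definition biorthogonal x xs : Prop :=
  forall n m : nat, xs n (x m) = (n == m)%:R.

Definition M_bounded (M : R) x xs : Prop :=
  [/\ bounded_set (range x), bounded_set (range xs)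
    & forall n, `|x n| * `|xs n| <= M].

Definition bounded_system x xs : Prop := exists M : R, M_bounded M x xs.

Definition fundamental_system x : Prop := closed_span (range x) = setT.

(* Density of the linear span in the weak* topology, not in the norm of X^*. *)
Definition total_system xs : Prop :=
  closure (lin_span (range xs) : set (weak_star X)) = setT.

Definition semi_normalized xs : Prop :=
  bounded_set (range xs) /\ exists2 c : R, 0 < c & forall n, c <= `|xs n|.

Definition wc0star_biorthogonal x xs : Prop :=
  [/\ biorthogonal x xs, semi_normalized xs & weakly_cvg xs 0].

End Biorthogonal.

(* Main.v *)
Require Import Defs.
From HB Require Import structures.
From mathcomp Require Import all_boot all_order all_algebra.
From mathcomp Require Import all_classical all_reals all_analysis.
From mathcomp Require Import ring lra.

Set Implicit Arguments.
Unset Strict Implicit.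
Unset Printing Implicit Defensive.

Import Order.TTheory GRing.Theory Num.Theory.
Import numFieldNormedType.Exports.

Local Open Scope classical_set_scope.
Local Open Scope ring_scope.

(* Let (f_k) be a normalized weakly null sequence in X^* and let u_k in the unit
   ball of X almost norm f_k.  The u_k converge along an ultrafilter to some c in
   X^** for the topology sigma(X^**, X^* ), and since c(f_k) -> 0 the f_k can be
   perturbed so that c(f_k) = 0.  Any finite biorthogonal system can then be
   extended by a pair close to (u, f_k): for k large f_k almost vanishes on the
   vectors of the system, and u is almost annihilated by its functionals, where
   - u = u_k, of norm at most 1, if all the functionals lie in ker c;
   - u = u_k - u_l with l much larger than k, of norm at most 2, in general.
   The first choice gives the (1 + eps)-bounded system.  For the fundamental total
   one, Gram-Schmidt steps adjoin pairs (y, h) with no control on the norms so as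
   to absorb, one at a time, a dense sequence and a norming sequence of
   functionals.  Each (y, h) is mixed at once with 2^N - 1 pairs (x, g) of the
   second kind by the Haar orthogonal matrix (Olevskii, Ovsepian-Pelczynski),
   which divides |y| and |h| by 2^(N/2) and costs a factor
   sum_(j >= 1) 2^(-j/2) = 1 + sqrt 2 on the bounds 2 for |x| and 1 for |g|. *)

(** * Elementary facts on the dual and the bidual *)

Section Dual.
Variables (R : realType) (E : normedModType R).
Implicit Types (f g : dual E) (x : E).

Lemma dual_sumE (I : Type) (r : seq I) (F : I -> dual E) x :
  (\sum_(i <- r) F i) x = \sum_(i <- r) F i x.
Proof. by elim/big_rec2: _ => // i y f _ <-. Qed.

Lemma dual_le f x : `|f x| <= `|f| * `|x|.
Proof. exact: dual_normP. Qed.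

Lemma exists_dual (f : E -> R) (M : R) : 0 <= M -> linear f ->
  (forall x, `|f x| <= M * `|x|) ->
  exists2 F : dual E, (forall x, F x = f x) & `|F| <= M.
Proof.
move=> M0 lf fM.
pose fL := GRing.isLinear.Build R E R *:%R f lf.
pose f' : {linear E -> R} := HB.pack f fL.
have cf : continuous f.
  apply/(@linear_bounded_continuous _ _ _ f')/bounded_funP => r.
  exists (M * r) => x xr; apply: le_trans (fM x) _; exact: ler_wpM2l.
have df : dual_pred f by apply/asboolP; split.
exists (Dual df) => //; apply: dual_norm_le => x x1 /=.
by apply: le_trans (fM x) _; rewrite -[leRHS]mulr1; exact: ler_wpM2l.
Qed.

End Dual.

Section Evaluation.
Variables (R : realType) (E : normedModType R).
Implicit Types (f g : dual E) (x : E).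

Lemma exists_eval x :
  exists2 F : dual (dual E), (forall f, F f = f x) & `|F| <= `|x|.
Proof.
apply: (@exists_dual _ (dual E) (fun f => f x)) => // f.
by rewrite mulrC; exact: dual_le.
Qed.

Lemma weakly_cvg_eval (f : nat -> dual E) g x :
  weakly_cvg f g -> f n x @[n --> \oo] --> g x.
Proof.
have [F Fx _] := exists_eval x.
by move=> /weakly_cvgP/(_ F); under eq_fun do rewrite Fx; rewrite Fx.
Qed.

End Evaluation.

(** * Linear spans *)

Section LinSpan.
Variables (R : realType) (E : normedModType R).
Implicit Types (A B : set E) (x y : E).

Lemma lin_span0 A : lin_span A 0.
Proof.
by exists 0%N, (fun=> 0), (fun=> 0); split=> [[]//|]; rewrite big_ord0.
Qed.

Lemma lin_span_incl A : A `<=` lin_span A.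
Proof.
move=> x Ax; exists 1%N, (fun=> 1), (fun=> x); split=> //.
by rewrite big_ord1 scale1r.
Qed.

Lemma lin_spanP A a x y :
  lin_span A x -> lin_span A y -> lin_span A (a *: x + y).
Proof.
move=> [n [b [v [Av ->]]]] [m [c [w [Aw ->]]]].
exists (n + m)%N,
  (fun i : 'I_(n + m) =>
     match fintype.split i with inl j => a * b j | inr j => c j end),
  (fun i : 'I_(n + m) =>
     match fintype.split i with inl j => v j | inr j => w j end).
split=> [i|]; first by case: (fintype.split i) => j; [exact: Av|exact: Aw].
rewrite big_split_ord scaler_sumr; congr (_ + _); apply: eq_bigr => i _.
  case: splitP => j /= ij; first by rewrite scalerA (ord_inj ij).
  by have := ltn_ord i; rewrite ij ltnNge leq_addr.
case: splitP => j /= ij; first by have := ltn_ord j; rewrite -ij ltnNge leq_addr.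
by rewrite (ord_inj (addnI ij)).
Qed.

Lemma lin_spanD A x y : lin_span A x -> lin_span A y -> lin_span A (x + y).
Proof. by move=> Ax Ay; rewrite -[x]scale1r; exact: lin_spanP. Qed.

Lemma lin_spanZ A a x : lin_span A x -> lin_span A (a *: x).
Proof. by move=> Ax; rewrite -[_ *: _]addr0; apply: lin_spanP (lin_span0 _). Qed.

Lemma lin_spanB A x y : lin_span A x -> lin_span A y -> lin_span A (x - y).
Proof. by move=> Ax Ay; rewrite addrC -scaleN1r; exact: lin_spanP. Qed.

Lemma lin_span_sum A (I : eqType) (r : seq I) (F : I -> E) :
  (forall i, i \in r -> lin_span A (F i)) -> lin_span A (\sum_(i <- r) F i).
Proof.
elim: r => [|i r IH] H; first by rewrite big_nil; exact: lin_span0.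
rewrite big_cons; apply: lin_spanD; first by apply: H; exact: mem_head.
by apply: IH => j jr; apply: H; rewrite inE jr orbT.
Qed.

Lemma lin_span_trans A B x :
  A `<=` lin_span B -> lin_span A x -> lin_span B x.
Proof.
move=> AB [n [a [v [Av ->]]]]; apply: lin_span_sum => i _.
by apply: lin_spanZ; exact: AB.
Qed.

Lemma lin_spanS A B : A `<=` B -> lin_span A `<=` lin_span B.
Proof. by move=> AB x; apply: lin_span_trans => y /AB; exact: lin_span_incl. Qed.

End LinSpan.

(** * Finite biorthogonal systems *)

Section FiniteSystems.
Variables (R : realType) (X : normedModType R).
Implicit Types (s t : seq (X * dual X)) (p q : X * dual X).
Implicit Types (x : X) (f : dual X).

Definition normalized p := p.2 p.1 == 1.
Definition orthogonal p q := (p.2 q.1 == 0) && (q.2 p.1 == 0).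
Definition biorth s := all normalized s && pairwise orthogonal s.

Definition vectors s : set X := [set x | x \in unzip1 s].
Definition functionals s : set (dual X) := [set f | f \in unzip2 s].

(* The components of [x] and [f] outside the finite system [s]. *)
Definition res s x := x - \sum_(p <- s) p.2 x *: p.1.
Definition cores s f := f - \sum_(p <- s) f p.1 *: p.2.

Lemma orthogonalC p q : orthogonal p q = orthogonal q p.
Proof. exact: andbC. Qed.

Lemma biorth_cons p s :
  biorth (p :: s) = [&& normalized p, all (orthogonal p) s & biorth s].
Proof. by rewrite /biorth /= -!andbA; congr (_ && _); rewrite andbCA. Qed.

(** Orthogonality is symmetric, so the order is immaterial: new pairs enter at the head but are
    stored at the tail. *)
Lemma biorth_catC s t : biorth (s ++ t) = biorth (t ++ s).
Proof.
rewrite /biorth !all_cat !pairwise_cat allrelC.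
rewrite (eq_allrel (r' := orthogonal)) => [|p q]; last exact: orthogonalC.
by congr (_ && _); [exact: andbC|congr (_ && _); exact: andbC].
Qed.

Lemma biorth_orth s p q : biorth (p :: s) -> q \in s ->
  p.2 q.1 = 0 /\ q.2 p.1 = 0.
Proof. by rewrite biorth_cons => /and3P[_ /allP H _] /H /andP[/eqP + /eqP]. Qed.

Lemma biorth_norm s p : biorth s -> p \in s -> p.2 p.1 = 1.
Proof. by move=> /andP[/allP H _] /H /eqP. Qed.

Lemma res_orth s p x : biorth s -> p \in s -> p.2 (res s x) = 0.
Proof.
rewrite /res linearB linear_sum /=.
under eq_bigr do rewrite linearZ /=.
suff H : biorth s -> p \in s -> \sum_(q <- s) q.2 x * p.2 q.1 = p.2 x.
  by move=> bs ps; rewrite H// subrr.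
elim: s => // q s IH bs; rewrite inE big_cons.
have bs' : biorth s by move: bs; rewrite biorth_cons => /and3P[].
case/orP => [/eqP ->|ps]; last first.
  by rewrite (biorth_orth bs ps).2 mulr0 add0r IH.
rewrite (biorth_norm bs) ?mem_head// mulr1 big_seq big1 ?addr0// => r rs.
by rewrite (biorth_orth bs rs).1 mulr0.
Qed.

(** [cores s] is the adjoint of [res s], so its properties are read off from those of [res s]. *)
Lemma cores_res s f x : cores s f x = f (res s x).
Proof.
rewrite /res linearB linear_sum /=; congr (_ - _).
by rewrite dual_sumE; apply: eq_bigr => p _; rewrite linearZ; exact: mulrC.
Qed.

Lemma res_vector s p : biorth s -> p \in s -> res s p.1 = 0.
Proof.
suff H : biorth s -> p \in s -> \sum_(q <- s) q.2 p.1 *: q.1 = p.1.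
  by move=> bs ps; rewrite /res H// subrr.
elim: s => // q s IH bs; rewrite inE big_cons.
have bs' : biorth s by move: bs; rewrite biorth_cons => /and3P[].
case/orP => [/eqP ->|ps]; last first.
  by rewrite (biorth_orth bs ps).1 scale0r add0r IH.
rewrite (biorth_norm bs) ?mem_head// scale1r big_seq big1 ?addr0// => r rs.
by rewrite (biorth_orth bs rs).2 scale0r.
Qed.

Lemma cores_orth s p f : biorth s -> p \in s -> cores s f p.1 = 0.
Proof. by move=> bs ps; rewrite cores_res res_vector// linear0. Qed.

Lemma res_id s x : biorth s -> res s (res s x) = res s x.
Proof.
move=> bs; rewrite {1}/res big_seq big1 ?subr0// => p ps.
by rewrite res_orth// scale0r.
Qed.

Lemma resZ s a x : res s (a *: x) = a *: res s x.
Proof.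
rewrite /res scalerBr scaler_sumr; congr (_ - _).
by apply: eq_bigr => p _; rewrite linearZ scalerA.
Qed.

(** A Gram-Schmidt step. The new pair is normalized because [res s] is idempotent:
    [cores s f (res s x)] is [f (res s (res s x))], that is [f (res s x)]. *)
Lemma biorth_extend s x f : biorth s -> f (res s x) = 1 ->
  biorth ((res s x, cores s f) :: s).
Proof.
move=> bs fx; rewrite biorth_cons bs andbT; apply/andP; split.
  by apply/eqP; rewrite -fx cores_res res_id.
by apply/allP => p ps; apply/andP; split; apply/eqP;
  [exact: cores_orth|exact: res_orth].
Qed.

Lemma res_span s x : lin_span (vectors s) (x - res s x).
Proof.
rewrite /res opprB addrC subrK; apply: lin_span_sum => p ps.
by apply/lin_spanZ/lin_span_incl; exact: map_f.
Qed.

Lemma cores_span s f : lin_span (functionals s) (f - cores s f).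
Proof.
rewrite /cores opprB addrC subrK; apply: lin_span_sum => p ps.
by apply/lin_spanZ/lin_span_incl; exact: map_f.
Qed.

Lemma vectors_cat s t : vectors (s ++ t) = vectors s `|` vectors t.
Proof.
apply/seteqP; split=> x; rewrite /vectors /= /unzip1 map_cat mem_cat => /orP //.
Qed.

Lemma functionals_cat s t : functionals (s ++ t) = functionals s `|` functionals t.
Proof.
apply/seteqP; split=> x; rewrite /functionals /= /unzip2 map_cat mem_cat => /orP //.
Qed.

End FiniteSystems.

(** * The Hahn-Banach theorem *)

Section HahnBanach.
Variables (R : realType) (E : normedModType R).
Implicit Types (G H : set (E * R)) (x y d : E).

(** Partial functionals are encoded by graphs in [E * R], so that extension is inclusion and Zorn's
    lemma for sets applies. Single-valuedness will follow from linearity and domination by the norm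
    at [0]. *)
Definition lin_graph G := forall (a : R) p q, G p -> G q ->
  G (a *: p.1 + q.1, a * p.2 + q.2).

Definition short_graph G := forall p, G p -> p.2 <= `|p.1|.

Definition line_graph d : set (E * R) := [set (t *: d, t * `|d|) | t in setT].

(** The value [r] at [x] must lie between all [p.2 - |p.1 - x|] and all [|q.1 + x| - q.2]. The
    triangle inequality makes this possible, and [r] is the supremum of the lower bounds. *)
Lemma lin_graph_extend H x : lin_graph H -> short_graph H -> H (0, 0) ->
  exists G, [/\ lin_graph G, short_graph G, H `<=` G & exists r, G (x, r)].
Proof.
move=> lH sH H0.
have HZ a p : H p -> H (a *: p.1, a * p.2).
  by move=> Hp; have := lH a _ _ Hp H0; rewrite !addr0.
pose S := [set p.2 - `|p.1 - x| | p in H].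
have Sub q : H q -> ubound S (`|q.1 + x| - q.2).
  move=> Hq _ [p Hp <-]; have := sH _ (lH 1 _ _ Hp Hq); rewrite /= scale1r mul1r.
  have := ler_normD (p.1 - x) (q.1 + x); rewrite addrACA addNr addr0; lra.
have supS : has_sup S.
  split; first by exists (0 - `|0 - x|), (0, 0).
  by exists (`|0 + x| - 0); exact: Sub H0.
pose r := sup S.
have r1 p : H p -> p.2 - `|p.1 - x| <= r.
  by move=> Hp; apply: (ub_le_sup supS.2); exists p.
have r2 q : H q -> r <= `|q.1 + x| - q.2.
  by move=> Hq; apply: ge_sup; [exact: supS.1|exact: Sub].
exists [set (p.1 + t *: x, p.2 + t * r) | p in H & t in setT]; split.
- move=> a _ _ [p Hp [t _ <-]] [q Hq [u _ <-]] /=.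
  exists (a *: p.1 + q.1, a * p.2 + q.2); first exact: lH.
  exists (a * t + u) => //=; congr (_, _); last ring.
  by rewrite scalerDl scalerDr scalerA addrACA.
(* Dividing by [|t|] reduces the inequality to [r2] when [t > 0] and to [r1] when [t < 0]. *)
- move=> _ [p Hp [t _ <-]] /=; have [t0|t0|->] := ltgtP t 0; last first.
  + by rewrite mul0r scale0r !addr0; exact: sH.
  + have nE : t * `|t^-1 *: p.1 + x| = `|p.1 + t *: x|.
      rewrite -{1}(gtr0_norm t0) -normrZ scalerDr scalerA divff ?gt_eqF//.
      by rewrite scale1r.
    have := r2 _ (HZ t^-1 _ Hp); rewrite /= -(ler_pM2l t0) mulrBr nE mulrA.
    by rewrite divff ?gt_eqF// mul1r; lra.
  + have nt0 : 0 < - t by rewrite oppr_gt0.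
    have nE : - t * `|(- t)^-1 *: p.1 - x| = `|p.1 + t *: x|.
      rewrite -{1}(gtr0_norm nt0) -normrZ scalerBr scalerA divff ?gt_eqF//.
      by rewrite scale1r scaleNr opprK.
    have := r1 _ (HZ (- t)^-1 _ Hp); rewrite /= -(ler_pM2l nt0) mulrBr nE mulrA.
    by rewrite divff ?gt_eqF// mul1r; lra.
- move=> [y s] Hy; exists (y, s) => //; exists 0 => //=.
  by rewrite scale0r mul0r !addr0.
- by exists r, (0, 0) => //; exists 1 => //=; rewrite scale1r mul1r !add0r.
Qed.

(** By Zorn's lemma there is a maximal dominated linear graph extending the line through [d], on
    which the value at [t *: d] is [t * |d|]; maximality makes it defined everywhere. *)
Lemma hahn_banach_norming d :
  exists f : dual E, `|f| <= 1 /\ f d = `|d|.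
Proof.
(* The line is adjoined in [P] so that the union of the empty chain satisfies it. *)
pose P G := lin_graph (G `|` line_graph d) /\ short_graph (G `|` line_graph d).
have lL : lin_graph (line_graph d).
  move=> a _ _ [t _ <-] [u _ <-] /=; exists (a * t + u) => //.
  by rewrite scalerDl scalerA mulrDl mulrA.
have sL : short_graph (line_graph d).
  by move=> _ [t _ <-] /=; rewrite normrZ ler_wpM2r// ler_norm.
have [F FP Ftot|A [[lA sA] maxA]] := @Zorn_bigcup _ P.
  split.
    have up G p q : F G -> (G `|` line_graph d) p -> (G `|` line_graph d) q ->
        forall a,
          (\bigcup_(X in F) X `|` line_graph d) (a *: p.1 + q.1, a * p.2 + q.2).
      move=> FG Gp Gq a; have [+ _] := FP _ FG.
      by move=> /(_ a _ _ Gp Gq) [?|?]; [left; exists G|right].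
    move=> a p q [[G FG Gp]|Lp] [[K FK Kq]|Lq].
    + have [GK|KG] := Ftot _ _ FG FK.
        by apply: (up K) => //; left => //; exact: GK.
      by apply: (up G) => //; left => //; exact: KG.
    + by apply: (up G) => //; [left|right].
    + by apply: (up K) => //; [right|left].
    + by right; exact: lL.
  move=> p [[G FG Gp]|Lp]; last exact: sL.
  by have [_] := FP _ FG; apply; left.
pose H := A `|` line_graph d.
have H0 : H (0, 0) by right; exists 0 => //; rewrite scale0r mul0r.
have Htot x : exists r, H (x, r).
  (* The extension [G] at [x] contains the line, hence satisfies [P]; maximality of [A] then forces
     [(x, r)] into [A]. *)
  have [G [lG sG HG [r Gr]]] := lin_graph_extend x lA sA H0.
  exists r; left; apply: contrapT => nA.
  have GE : G `|` line_graph d = G.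
    by apply/seteqP; split=> [p [//|Lp]|p]; [apply: HG; right|left].
  apply: (maxA G); last by rewrite /P GE.
  split; last by move=> GA; apply: nA; exact: GA.
  by move=> p Ap; apply: HG; left.
have Hfun x r s : H (x, r) -> H (x, s) -> r = s.
  have le u v : H (x, u) -> H (x, v) -> u <= v.
    move=> Hu Hv; have := sA _ (lA (-1) _ _ Hv Hu) => /=.
    by rewrite scaleN1r addNr normr0; lra.
  by move=> Hr Hs; apply/eqP; rewrite eq_le !le.
pose f x := projT1 (cid (Htot x)).
have Hf x : H (x, f x) by rewrite /f; case: cid.
have f_lin : linear f.
  by move=> a x y; apply: Hfun (Hf _) (lA a _ _ (Hf x) (Hf y)).
have fN x : f (- x) = - f x.
  apply: Hfun (Hf _) _; have := lA (-1) _ _ (Hf x) H0.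
  by rewrite /= scaleN1r mulN1r !addr0.
have f_short x : `|f x| <= 1 * `|x|.
  rewrite mul1r ler_norml lerNl -fN -{1}(normrN x).
  by rewrite (sA _ (Hf (- x))) (sA _ (Hf x)).
have [g gf g1] := exists_dual ler01 f_lin f_short.
exists g; split=> //; rewrite gf; apply: Hfun (Hf d) _; right.
by exists 1 => //; rewrite scale1r mul1r.
Qed.

End HahnBanach.

(** * Weakly null sequences and almost norming vectors *)

(** Along indices where [v] stays at distance more than [e] from its weak limit, normalizing the
    differences costs at most a factor [1 / e], so weak nullity survives. *)
Lemma not_schur_normalized_null (R : realType) (E : normedModType R) :
  ~ schur_property E ->
  exists f : nat -> E, (forall n, `|f n| = 1) /\ weakly_cvg f 0.
Proof.
move=> nS; have [v [x [vx ncv]]] : exists v x, weakly_cvg (E := E) v x /\ ~ cvgn v.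
  apply: contrapT => H; apply: nS => v x vx.
  by apply: contrapT => ncv; apply: H; exists v, x.
have [e e0 far] : exists2 e : R, 0 < e &
    forall N, exists2 n, (N <= n)%N & e < `|x - v n|.
  apply: contrapT => H; apply: ncv; apply/cvg_ex; exists x.
  apply/cvgrPdist_le => e e0; apply: contrapT => nH; apply: H.
  exists e => // N; apply: contrapT => nN; apply: nH; exists N => // n /= Nn.
  by rewrite leNgt; apply/negP => ?; apply: nN; exists n.
pose i N := projT1 (cid2 (far N)).
have iN N : (N <= i N)%N by rewrite /i; case: cid2.
have ei N : e < `|x - v (i N)| by rewrite /i; case: cid2.
have n0 N : 0 < `|x - v (i N)| by rewrite (lt_trans e0).
exists (fun N => `|x - v (i N)|^-1 *: (x - v (i N))); split=> [N|].
  by rewrite normrZ normfV normr_id mulVf// gt_eqF.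
apply/weakly_cvgP => F; rewrite linear0.
have H : F x - F (v (i N)) @[N --> \oo] --> (0 : R).
  rewrite -(subrr (F x)); apply: cvgB; first exact: cvg_cst.
  apply: (cvg_comp i (fun n => F (v n))) (iffLR (weakly_cvgP _ _) vx F).
  by move=> A [N _ NA]; exists N => // n /= /leq_trans/(_ (iN n)) /NA.
apply/cvgr0Pnorm_le => d d0.
have Hd : \forall N \near \oo, `|F x - F (v (i N))| <= d * e.
  by apply: cvgr0_norm_le => //; exact: mulr_gt0.
apply: filterS Hd => N HN.
rewrite linearZ linearB/= normrM normfV normr_id ler_pdivrMl// mulrC.
by rewrite (le_trans HN)// ler_pM2l// ltW.
Qed.

(** A form of weak* compactness of the bidual ball: each bounded scalar sequence [f (u n)] converges
    along [U], and the limit is linear in [f] and bounded by [|f|]. *)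
Lemma ultrafilter_limit (R : realType) (E : normedModType R) (U : set_system nat)
    (u : nat -> E) : UltraFilter U -> (forall n, `|u n| <= 1) ->
  exists c : dual (dual E), forall f : dual E, f (u n) @[n --> U] --> c f.
Proof.
move=> UU u1.
have UP : ProperFilter U by exact: ultra_proper.
have cv (f : dual E) : exists a : R, f (u n) @[n --> U] --> a.
  have [|a [_ Ha]] := @segment_compact R (- `|f|) `|f| (f (u n) @[n --> U]) _.
    apply: (@filterE _ U) => n /=; rewrite in_itv /= -ler_norml.
    by apply: le_trans (dual_le _ _) _; rewrite -[leRHS]mulr1 ler_wpM2l.
  exists a => A aA.
  (* A cluster point of an ultrafilter is a limit: otherwise [U] would contain the preimage of the
     complement of some neighbourhood. *)
  have [//|nA] := in_ultra_setVsetC ((fun n => f (u n)) @^-1` A) UU.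
  by have [y []] := Ha (~` A) A nA aA.
pose c f := projT1 (cid (cv f)).
have cP (f : dual E) : f (u n) @[n --> U] --> c f by rewrite /c; case: cid.
have c_lin : linear c.
  move=> a f g; apply: (norm_cvg_unique (cP _)).
  by apply: cvgD; [apply: cvgZl_tmp; exact: cP|exact: cP].
have c_le f : `|c f| <= 1 * `|f|.
  rewrite mul1r; apply: (cvgr_to_le (cvg_norm (cP f))); apply: filterE => n.
  by apply: le_trans (dual_le _ _) _; rewrite -[leRHS]mulr1 ler_wpM2l.
have [F Fc _] := exists_dual ler01 c_lin c_le.
by exists F => f; rewrite Fc.
Qed.

Lemma filter_forall_seq (T : Type) (F : set_system T) (I : eqType) (s : seq I)
    (P : I -> T -> Prop) : Filter F -> (forall i, i \in s -> F (P i)) ->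
  F [set x | forall i, i \in s -> P i x].
Proof.
move=> FF; elim: s => [|i s IH] H; first by apply: filterE.
have Hi : F (P i) by apply: H; rewrite mem_head.
have Hs : F [set x | forall i, i \in s -> P i x].
  by apply: IH => j js; apply: H; rewrite inE js orbT.
apply: filterS (filterI Hi Hs) => x [Pi Ps] j.
by rewrite inE => /orP[/eqP ->|/Ps].
Qed.

Lemma cvg0_near_le (R : realType) (T : Type) (F : set_system T) (a : T -> R)
    (d : R) :
  Filter F -> a x @[x --> F] --> 0 -> 0 < d -> F [set x | `|a x| <= d].
Proof. by move=> FF a0 d0; exact: (cvgr0_norm_le _ a0). Qed.

Lemma dual_almost_norming (R : realType) (E : normedModType R) (f : dual E)
    (e : R) :
  0 < e -> exists x, `|x| <= 1 /\ `|f| - e <= f x.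
Proof.
move=> e0; have [_ [x /= x1 <-] fx] := sup_adherent e0 (dual_norm_has_sup f).
have [f0|f0] := leP 0 (f x).
  by exists x; split=> //; apply: ltW; move: fx; rewrite ger0_norm.
exists (- x); rewrite normrN linearN; split=> //.
by apply: ltW; move: fx; rewrite ltr0_norm.
Qed.

Section Supply.
Variables (R : realType) (X : normedModType R).

Lemma not_schur_tested : ~ schur_property (dual X) ->
  exists (f : nat -> dual X) (u : nat -> X) (U : set_system nat)
         (c : dual (dual X)),
    [/\ ProperFilter U /\ \oo `<=` U,
        forall k, [/\ `|f k| <= 1, `|u k| <= 1 & c (f k) = 0],
        weakly_cvg f 0,
        forall d, 0 < d -> \forall k \near \oo, 1 - d <= f k (u k)
      & forall g : dual X, g (u k) @[k --> U] --> c g].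
Proof.
move=> /not_schur_normalized_null[g [g1 g0]].
have e_gt0 k : 0 < k.+1%:R^-1 :> R by rewrite invr_gt0 ltr0n.
pose u k := projT1 (cid (dual_almost_norming (g k) (e_gt0 k))).
have u1 k : `|u k| <= 1 by rewrite /u; case: cid => ? [].
have gu k : 1 - k.+1%:R^-1 <= g k (u k).
  by rewrite -{1}(g1 k) /u; case: cid => ? [].
have [U [UU oU]] := @ultraFilterLemma nat \oo _.
have UP : ProperFilter U by exact: ultra_proper.
have [c uc] := ultrafilter_limit UU u1.
(* [k - c k *: h] projects onto the kernel of [c]: take [c h = 1], or [h = 0] when [c] vanishes. *)
have [h ch] : exists h : dual X, forall k : dual X, c (k - c k *: h) = 0.
  have [[h0 h0P]|H] := pselect (exists h, c h != 0).
    exists ((c h0)^-1 *: h0) => k.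
    have -> : c (k - c k *: ((c h0)^-1 *: h0)) = c k - c k * ((c h0)^-1 * c h0).
      by rewrite linearB !linearZ.
    by rewrite mulVf// mulr1 subrr.
  exists 0 => k; rewrite scaler0 subr0; apply/eqP/negPn/negP => k0.
  by apply: H; exists k.
pose b k := `|c (g k)| * `|h|.
have b0 k : 0 <= b k by rewrite mulr_ge0.
have n0 k : 0 < 1 + b k by rewrite ltr_pwDl.
have cg : c (g k) @[k --> \oo] --> (0 : R).
  by have /weakly_cvgP/(_ c) := g0; rewrite linear0.
have cb : b k @[k --> \oo] --> (0 : R).
  by rewrite -(mul0r `|h|); apply: cvgMr_tmp; rewrite -(normr0 R); exact: cvg_norm.
(* The projected functional has norm at most [1 + b k], so the division restores the bound 1. As
   [b k] tends to 0, weak nullity and almost norming persist. *)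
exists (fun k => (1 + b k)^-1 *: (g k - c (g k) *: h)), u, U, c; split=> //.
- move=> k; split=> //; last by rewrite linearZ /= ch scaler0.
  rewrite normrZ gtr0_norm ?invr_gt0// ler_pdivrMl// mulr1.
  by rewrite (le_trans (ler_normB _ _))// normrZ g1.
- apply/weakly_cvgP => F; rewrite linear0.
  have -> : 0 = (1 + 0)^-1 * (0 - 0 * F h) :> R by ring.
  under eq_fun do rewrite linearZ linearB linearZ /=.
  apply: cvgM; last first.
    apply: cvgB; last by apply: cvgMr_tmp.
    by have /weakly_cvgP/(_ F) := g0; rewrite linear0.
  by apply: cvgV; [rewrite addr0 oner_neq0|apply: cvgD => //; exact: cvg_cst].
- move=> d d0; have d3 : 0 < d / 3 by rewrite divr_gt0.
  have H1 : \forall k \near \oo, `|b k| <= d / 3 by exact: cvgr0_norm_le.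
  have H2 : \forall k \near \oo, `|k.+1%:R^-1 : R| <= d / 3.
    by apply: cvgr0_norm_le => //; exact: cvg_harmonic.
  apply: filterS2 H1 H2 => k; rewrite !ger0_norm// => H1 H2.
  have -> : ((1 + b k)^-1 *: (g k - c (g k) *: h)) (u k) =
            (1 + b k)^-1 * (g k (u k) - c (g k) * h (u k)) by [].
  rewrite ler_pdivlMl//.
  have : c (g k) * h (u k) <= b k.
    rewrite (le_trans (ler_norm _))// normrM ler_wpM2l//.
    by apply: le_trans (dual_le _ _) _; rewrite -[leRHS]mulr1 ler_wpM2l.
  have := gu k; have := b0 k; move: (g k (u k)) (c _ * _) (b k) H1 H2.
  move: (k.+1%:R^-1) => e v w B; nra.
Qed.

(** The input of every extension step. Restricting the listed functionals to [S] allows a smaller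
    [C]: below, [S] is the kernel of [c] with [C = 1], or everything with [C = 2]. *)
Definition supply (f : nat -> dual X) (S : set (dual X)) (C : R) :=
  forall (s : seq (X * dual X)) (d : R) (K : nat),
    0 < d -> (forall p, p \in s -> S p.2) ->
  exists k u, [/\ (K <= k)%N, `|u| <= C, 1 - d <= f k u
    & forall p, p \in s -> `|f k p.1| <= d /\ `|p.2 u| <= d].

Lemma not_schur_supply : ~ schur_property (dual X) ->
  exists (f : nat -> dual X) (S : set (dual X)),
    [/\ forall k, `|f k| <= 1 /\ S (f k),
        forall a g h, S g -> S h -> S (a *: g + h),
        weakly_cvg f 0, supply f S 1 & supply f setT 2].
Proof.
move=> /not_schur_tested[f [u [U [c [[UP oU] fu1 f0 fu uc]]]]].
exists f, [set g | c g = 0]; split=> //.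
- by move=> k; have [] := fu1 k.
- move=> a g h /= cg ch.
  have -> : c (a *: g + h) = a * c g + c h by rewrite linearP.
  by rewrite cg ch mulr0 addr0.
- move=> s d K d0 Ss.
  have H1 : U [set k | (K <= k)%N] by apply: oU; exists K.
  have H2 : U [set k | 1 - d <= f k (u k)] by apply: oU; exact: fu.
  have H3 : U [set k | forall p, p \in s -> `|f k p.1| <= d].
    apply: filter_forall_seq => p ps; apply: oU.
    have fp : f k p.1 @[k --> \oo] --> (0 : R) by exact: weakly_cvg_eval f0.
    exact: cvg0_near_le fp d0.
  have H4 : U [set k | forall p, p \in s -> `|p.2 (u k)| <= d].
    apply: filter_forall_seq => p ps.
    have pu : p.2 (u k) @[k --> U] --> (0 : R) by rewrite -(Ss p ps); exact: uc.
    exact: cvg0_near_le pu d0.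
  have [k [[Kk fk] [sk tk]]] := filter_ex (filterI (filterI H1 H2) (filterI H3 H4)).
  exists k, (u k); split=> //; first by have [] := fu1 k.
  by move=> p ps; split; [exact: sk|exact: tk].
- move=> s d K d0 _; have d2 : 0 < d / 2 by rewrite divr_gt0.
  have H1 : U [set k | (K <= k)%N] by apply: oU; exists K.
  have H2 : U [set k | 1 - d / 2 <= f k (u k)] by apply: oU; exact: fu.
  have H3 : U [set k | forall p, p \in s -> `|f k p.1| <= d].
    apply: filter_forall_seq => p ps; apply: oU.
    have fp : f k p.1 @[k --> \oo] --> (0 : R) by exact: weakly_cvg_eval f0.
    exact: cvg0_near_le fp d0.
  have H4 : U [set k | forall p, p \in s -> `|c p.2 - p.2 (u k)| <= d / 2].
    apply: filter_forall_seq => p ps.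
    have /cvgrPdist_le/(_ _ d2) := uc p.2; exact.
  have [k [[Kk fk] [sk tk]]] := filter_ex (filterI (filterI H1 H2) (filterI H3 H4)).
  (* With [k] fixed, [l] is chosen so that [f k (u l)] is small, as [c (f k) = 0], and [p.2 (u l)]
     is near [c p.2], which cancels in [u k - u l]. *)
  have H5 : U [set l | `|f k (u l)| <= d / 2].
    have [_ _ cf] := fu1 k; have := uc (f k); rewrite cf => ck.
    exact: cvg0_near_le ck d2.
  have [l [tl fl]] := filter_ex (filterI H4 H5).
  exists k, (u k - u l); split=> //.
  + have [_ uk _] := fu1 k; have [_ ul _] := fu1 l.
    by rewrite (le_trans (ler_normB _ _))// -[2]/(1 + 1) lerD.
  + rewrite linearB /=; have := ler_norm (f k (u l)); move: fk fl => /=; lra.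
  + move=> p ps; split; first exact: sk.
    have := tk p ps; have := tl p ps => /=; rewrite linearB /= !ler_norml.
    move=> /andP[? ?] /andP[? ?]; apply/andP; split; lra.
Qed.

End Supply.

(** * Extending finite systems, and passing to the limit *)

Section GoodStep.
Variables (R : realType) (X : normedModType R).
Implicit Types (s : seq (X * dual X)) (S : set (dual X)).

Lemma cores_closed S s g : (forall a h k, S h -> S k -> S (a *: h + k)) ->
  S g -> (forall p, p \in s -> S p.2) -> S (cores s g).
Proof.
move=> Slin Sg; rewrite /cores; elim: s => [|p s IH] Ss.
  by rewrite big_nil subr0.
rewrite big_cons opprD addrCA -scaleNr; apply: Slin.
  by apply: Ss; rewrite mem_head.
by apply: IH => q qs; apply: Ss; rewrite inE qs orbT.
Qed.

(** [res] and [cores] make a supplied pair [(u, f k)] orthogonal to [s] while moving it little. Only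
    the vector is then rescaled, so the functional remains close to [f k]. *)
Lemma good_pair f S (C e : R) s K :
  (forall k, `|f k| <= 1 /\ S (f k)) ->
  (forall a h k, S h -> S k -> S (a *: h + k)) ->
  supply f S C -> 0 <= C -> 0 < e -> biorth s -> (forall p, p \in s -> S p.2) ->
  exists p k, [/\ (K <= k)%N, biorth (p :: s), S p.2, `|p.1| <= C + e
    & `|p.2 - f k| <= e].
Proof.
move=> fS Slin sup C0 e0 bs Ss.
pose M := \sum_(p <- s) (`|p.1| + `|p.2|).
have M0 : 0 <= M by apply: sumr_ge0 => p _; rewrite addr_ge0.
(* [y] solves [(C + y) / (1 - y) = C + e]: below, the residual of [u] has norm at most [C + y] and
   is divided by [t >= 1 - y]. *)
pose y := e / (1 + C + e).
have Ce0 : 0 < 1 + C + e by rewrite ltr_pwDr// addr_ge0.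
have yE : y * (1 + C + e) = e by rewrite /y divfK// gt_eqF.
have y0 : 0 < y by rewrite divr_gt0.
have M1 : 0 < 1 + M by rewrite ltr_pwDl.
(* [d * (1 + M) = y] covers the defect [d] of [f k u] and a correction of at most [d * M]. *)
pose d := y / (1 + M).
have dE : d * (1 + M) = y by rewrite /d divfK// gt_eqF.
have d0 : 0 < d by rewrite divr_gt0.
have [k [u [Kk uC fu sk]]] := sup s d K d0 Ss.
have [fk1 Sfk] := fS k.
have res_le : `|u - res s u| <= d * M.
  rewrite /res opprB addrC subrK mulr_sumr big_seq [leRHS]big_seq.
  apply: le_trans (ler_norm_sum _ _ _) _; apply: ler_sum => p ps.
  by rewrite normrZ ler_pM// ?lerDl//; have [] := sk p ps.
have cores_le : `|cores s (f k) - f k| <= d * M.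
  rewrite distrC /cores opprB addrC subrK mulr_sumr big_seq [leRHS]big_seq.
  apply: le_trans (ler_norm_sum _ _ _) _; apply: ler_sum => p ps.
  by rewrite normrZ ler_pM// ?lerDr//; have [] := sk p ps.
pose t := f k (res s u).
have t_ge : 1 - y <= t.
  have : f k (u - res s u) <= d * M.
    apply: le_trans (ler_norm _) _; apply: le_trans (dual_le _ _) _.
    by rewrite -[leRHS]mul1r ler_pM.
  by rewrite linearB /= -/t; move: dE fu; lra.
have t0 : 0 < t.
  apply: lt_le_trans t_ge; rewrite subr_gt0 ltr_pdivrMr// mul1r.
  by rewrite -addrA ltr_pwDl// lerDr.
exists (res s (t^-1 *: u), cores s (f k)), k; split=> //.
- apply: biorth_extend => //; rewrite resZ linearZ.
  exact: (mulVf (lt0r_neq0 t0)).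
- exact: cores_closed.
- rewrite resZ /= normrZ gtr0_norm ?invr_gt0// ler_pdivrMl//.
  have : `|res s u| <= C + d * M.
    rewrite -[res s u](subrK u) addrC (le_trans (ler_normD _ _))// lerD//.
    by rewrite distrC.
  move: (`|_|) => z; move: dE d0 t_ge yE y0; nra.
- by rewrite (le_trans cores_le)//; move: dE d0 yE y0; nra.
Qed.

End GoodStep.

(** Dependent choice for lists: [I] is an invariant, [N n] relates the list before step [n] to the
    block appended there, and [l n] is the length before step [n]. *)
Lemma growing_lists (T : Type) (x0 : T) (I : seq T -> Prop)
    (N : nat -> seq T -> seq T -> Prop) :
  I [::] ->
  (forall n s, I s -> exists t, [/\ t <> [::], I (s ++ t) & N n s t]) ->
  exists (z : nat -> T) (l : nat -> nat),
    [/\ forall n, (l n < l n.+1)%N, l 0%N = 0%N,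
        forall n, I (mkseq z (l n))
      & forall n, N n (mkseq z (l n)) [seq z i | i <- iota (l n) (l n.+1 - l n)]].
Proof.
move=> I0 step.
have [h hP] : exists h : nat -> seq T -> seq T, forall n s, I s ->
    [/\ h n s <> [::], I (s ++ h n s) & N n s (h n s)].
  have H n s : exists t, I s -> [/\ t <> [::], I (s ++ t) & N n s t].
    have [Is|nI] := pselect (I s); last by exists [::].
    by have [t tP] := step n s Is; exists t.
  by exists (fun n s => projT1 (cid (H n s))) => n s Is; case: cid => t /= /(_ Is).
pose L := fix L n := if n is m.+1 then L m ++ h m (L m) else [::].
have IL n : I (L n) by elim: n => //= n IH; have [] := hP n _ IH.
have hL n : h n (L n) <> [::] /\ N n (L n) (h n (L n)).
  by have [] := hP n _ (IL n).
pose l n := size (L n).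
have lS n : (l n < l n.+1)%N.
  rewrite /l /= size_cat -[ltnLHS]addn0 ltn_add2l.
  by case: (h n (L n)) (hL n) => [[]|].
have nl n : (n <= l n)%N by elim: n => // n IH; exact: leq_ltn_trans (lS n).
(* Blocks are nonempty, so [L i.+1] already has an entry of index [i], and later lists keep it. *)
pose z i := nth x0 (L i.+1) i.
have Lpre n m i : (n <= m)%N -> (i < l n)%N -> nth x0 (L m) i = nth x0 (L n) i.
  move=> nm il; rewrite -(subnK nm); elim: (m - n)%N => // k <-.
  rewrite /= nth_cat; case: ltnP => //.
  suff: (l n <= l (k + n))%N by move=> + kl; rewrite leqNgt (leq_ltn_trans kl).
  by elim: k => // k IH; exact: leq_trans (ltnW (lS _)).
have zL n i : (i < l n)%N -> nth x0 (L n) i = z i.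
  move=> il; rewrite /z; have [ni|ni] := leqP n i.+1; first by rewrite (Lpre n).
  by rewrite (Lpre i.+1 n i (ltnW ni) (nl i.+1)).
have zE n : mkseq z (l n) = L n.
  apply: (eq_from_nth (x0 := x0)); first by rewrite size_mkseq.
  by move=> i; rewrite size_mkseq => il; rewrite nth_mkseq// zL.
exists z, l; split=> // n; first by rewrite zE.
rewrite zE; suff -> : [seq z i | i <- iota (l n) (l n.+1 - l n)] = h n (L n).
  by have [] := hL n.
have := zE n.+1; rewrite /mkseq -{1}(subnKC (ltnW (lS n))) iotaD map_cat.
rewrite -/(mkseq z (l n)) zE add0n /=.
by move=> /(congr1 (drop (size (L n)))); rewrite !drop_size_cat.
Qed.

Section LimitSystem.
Variables (R : realType) (X : normedModType R).
Implicit Types (f : nat -> dual X) (z : nat -> X * dual X) (h : dual X).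

(* Up to an error of order [d], [h] lies in [c] times the closed absolutely convex
   hull of the [f k], [n <= k]. *)
Definition near_tail (c : R) f n (d : R) h := forall (F : dual (dual X)) (b : R),
  (forall k, (n <= k)%N -> `|F (f k)| <= b) ->
  `|F h| <= c * (b + d * `|F|) + d * `|F|.

Lemma near_tailW (c d d' : R) f n m h : 0 <= c -> (n <= m)%N -> d' <= d ->
  near_tail c f m d' h -> near_tail c f n d h.
Proof.
move=> c0 nm dd H F b fb; have le : d' * `|F| <= d * `|F| by rewrite ler_wpM2r.
apply: (le_trans (H F b _)) => [k mk|]; first by apply: fb; exact: leq_trans mk.
by rewrite lerD// ler_wpM2l// lerD2l.
Qed.

(** For fixed [F], the tail bound on [F (f k)] and the error [e * |F| / n.+1] both tend to 0. *)
Lemma near_tail_null (c e : R) f (l : nat -> nat) (h : nat -> dual X) : 0 <= c ->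
  weakly_cvg f 0 ->
  (forall n i, (l n <= i)%N -> near_tail c f n (e / n.+1%:R) (h i)) ->
  weakly_cvg h 0.
Proof.
move=> c0 f0 H; apply/weakly_cvgP => F; rewrite linear0.
(* [b] is chosen so that [c * (b + b) + b = d]. *)
apply/cvgrPdist_le => d d0; pose b := d / (2 * c + 1).
have c1 : 0 < 2 * c + 1 by rewrite ltr_wpDl// mulr_ge0.
have b0 : 0 < b by rewrite divr_gt0.
have Ff : F (f k) @[k --> \oo] --> (0 : R).
  by have /weakly_cvgP/(_ F) := f0; rewrite linear0.
have eF : (e * `|F|) * k.+1%:R^-1 @[k --> \oo] --> (0 : R).
  by rewrite -(mulr0 (e * `|F|)); apply: cvgMl_tmp; exact: cvg_harmonic.
have [N _ HN] := filterI (cvg0_near_le _ Ff b0) (cvg0_near_le _ eF b0).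
exists (l N) => // i /= li; rewrite sub0r normrN.
apply: le_trans (H _ _ li F b _) _ => [k Nk|]; first by have [] := HN k Nk.
have [_] := HN N (leqnn N); rewrite /= => /(le_trans (ler_norm _)).
rewrite mulrAC; move: (_ * _) => y yb.
have -> : d = c * (b + b) + b.
  by rewrite -[d](divfK (lt0r_neq0 c1)) -/b; ring.
by rewrite lerD// ler_wpM2l// lerD2l.
Qed.

Lemma biorth_biorthogonal z (l : nat -> nat) : (forall n, (n <= l n)%N) ->
  (forall n, biorth (mkseq z (l n))) -> biorthogonal (fst \o z) (snd \o z).
Proof.
move=> nl bz n m /=; pose N := maxn n.+1 m.+1.
have zN i : (i < N)%N -> z i \in mkseq z (l N).
  by move=> iN; rewrite map_f// mem_iota add0n (leq_trans iN).
have nN : (n < N)%N by rewrite leq_max leqnn.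
have mN : (m < N)%N by rewrite leq_max leqnn orbT.
have [->|nm] := eqVneq n m; first exact: biorth_norm (bz N) (zN _ mN).
have /andP[_ /(pairwiseP (z 0%N)) H] := bz N.
have Hij i j : (i < N)%N -> (j < N)%N -> (i < j)%N -> orthogonal (z i) (z j).
  move=> iN jN ij; have iL := leq_trans iN (nl N); have jL := leq_trans jN (nl N).
  by have := H i j; rewrite !inE size_mkseq => /(_ iL jL ij); rewrite !nth_mkseq.
move: nm; rewrite neq_ltn => /orP[nm|mn].
  by have /andP[/eqP ->] := Hij _ _ nN mN nm.
by have /andP[_ /eqP ->] := Hij _ _ mN nN mn.
Qed.

(** The frame of both constructions: [I] is kept along the finite stages, and [Q n] is the task
    fulfilled by step [n]. The shrinking error [e / n.+1] makes the functionals weakly null. *)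
Lemma limit_system (I : seq (X * dual X) -> Prop)
    (Q : nat -> seq (X * dual X) -> Prop) f (c e A B : R) :
  0 <= c -> 0 <= e -> 0 <= A -> 0 <= B -> weakly_cvg f 0 ->
  I [::] -> (forall s, I s -> biorth s) ->
  (forall n s, I s -> exists t, [/\ t <> [::], I (s ++ t), Q n (s ++ t) &
     forall p, p \in t ->
       [/\ `|p.1| <= A, `|p.2| <= B & near_tail c f n (e / n.+1%:R) p.2]]) ->
  exists (x : nat -> X) (xs : nat -> dual X),
    [/\ wc0star_biorthogonal x xs, M_bounded (A * B) x xs
      & forall n, exists m, Q n (mkseq (fun i => (x i, xs i)) m)].
Proof.
move=> c0 e0 A0 B0 f0 I0 Ib step.
pose N n s t := Q n (s ++ t) /\ forall p, p \in t ->
  [/\ `|p.1| <= A, `|p.2| <= B & near_tail c f n (e / n.+1%:R) p.2].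
have [|z [l [lS l0 Iz Nz]]] := @growing_lists _ (0, 0) I N I0.
  by move=> n s /step -/(_ n)[t [? ? ? ?]]; exists t.
have nl n : (n <= l n)%N by elim: n => // n IH; exact: leq_ltn_trans (lS n).
have lmono n m : (n <= m)%N -> (l n <= l m)%N.
  by move=> /subnK <-; elim: (m - n)%N => // k IH; exact: leq_trans (ltnW (lS _)).
have block i : exists n, [/\ (l n <= i < l n.+1)%N &
    [/\ `|(z i).1| <= A, `|(z i).2| <= B & near_tail c f n (e / n.+1%:R) (z i).2]].
  have [n /andP[ni iS]] : exists n, (l n <= i < l n.+1)%N.
    elim: i => [|i [n /andP[ni iS]]].
      by exists 0%N; have := lS 0%N; rewrite l0 => ->.
    have [lt|ge] := ltnP i.+1 (l n.+1).
      by exists n; rewrite lt (leq_trans ni).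
    by exists n.+1; rewrite ge; exact: leq_ltn_trans iS (lS _).
  exists n; rewrite ni iS; split=> //; apply: (Nz n).2.
  by apply: map_f; rewrite mem_iota ni subnKC// ltnW.
have bz : biorthogonal (fst \o z) (snd \o z).
  by apply: (@biorth_biorthogonal z l) => // n; exact: Ib.
have zA i : `|(z i).1| <= A by have [n [_ []]] := block i.
have zB i : `|(z i).2| <= B by have [n [_ []]] := block i.
have bd (V : normedModType R) (v : nat -> V) (M : R) : (forall i, `|v i| <= M) ->
    bounded_set (range v).
  move=> vM; exists M; split; first exact: num_real.
  by move=> K MK _ [i _ <-]; exact: le_trans (vM i) (ltW MK).
exists (fst \o z), (snd \o z); split.
- split=> //.
    split; first exact: bd zB.
    (* This comes from [1 = (z i).2 (z i).1 <= |(z i).2| * A], with [A + 1] in place of [A] to have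
       a positive divisor. *)
    exists (A + 1)^-1; first by rewrite invr_gt0 ltr_wpDl.
    move=> i /=; rewrite -div1r ler_pdivrMr ?ltr_wpDl//.
    have zi : (z i).2 (z i).1 = 1 by have := bz i i; rewrite eqxx.
    rewrite -[leLHS]zi; apply: le_trans (ler_norm _) _.
    apply: le_trans (dual_le _ _) _; apply: ler_wpM2l => //.
    by apply: le_trans (zA i) _; rewrite lerDl.
  apply: (@near_tail_null c e f l) => // n i li.
  have [m [/andP[mi im] [_ _ mt]]] := block i.
  have nm : (n <= m)%N.
    rewrite -ltnS ltnNge; apply/negP => /lmono; rewrite leqNgt => /negP; apply.
    exact: leq_ltn_trans li im.
  apply: near_tailW mt => //.
  by rewrite ler_wpM2l// lef_pV2 ?posrE ?ltr0n// ler_nat.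
- split; [exact: bd zA|exact: bd zB|];
    by move=> i; apply: ler_pM => //; [exact: zA|exact: zB].
- move=> n; exists (l n.+1).
  have -> : mkseq (fun i => ((fst \o z) i, (snd \o z) i)) (l n.+1) =
      mkseq z (l n) ++ [seq z i | i <- iota (l n) (l n.+1 - l n)].
    rewrite /mkseq -map_cat -[in RHS](iotaD 0) (subnKC (ltnW (lS n))).
    by apply: eq_map => i /=; case: (z i).
  exact: (Nz n).1.
Qed.

End LimitSystem.

(** * Failure of the Schur property and (1 + eps)-bounded systems *)

Lemma wc0star_not_schur (R : realType) (X : normedModType R) (x : nat -> X)
    (xs : nat -> dual X) : wc0star_biorthogonal x xs -> ~ schur_property (dual X).
Proof.
move=> [_ [_ [c c0 xsc]] xs0] /(_ _ _ xs0)/cvg_ex[g xsg].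
(* The norm limit agrees with the weak limit at every evaluation; being 0, it contradicts the lower
   bound on the norms. *)
have g0 : g = 0.
  apply: val_inj; apply/funext => y /=.
  have [F Fy _] := exists_eval y.
  have H1 : F (xs n) @[n --> \oo] --> F g.
    by apply: (cvg_comp _ _ xsg); exact: dual_continuous.
  have H2 : F (xs n) @[n --> \oo] --> F 0 by have /weakly_cvgP := xs0; exact.
  have : F g = F 0 by exact: norm_cvg_unique H1 H2.
  by rewrite linear0 Fy.
move: xsg; rewrite g0 => /cvgr0Pnorm_lt/(_ _ c0)[N _ /(_ N (leqnn N))] /=.
by move=> H; have := lt_le_trans H (xsc N); rewrite ltxx.
Qed.

Lemma M_boundedW (R : realType) (X : normedModType R) (x : nat -> X)
    (xs : nat -> dual X) (M M' : R) :
  M <= M' -> M_bounded M x xs -> M_bounded M' x xs.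
Proof. by move=> MM [bx bxs bM]; split=> // n; exact: le_trans (bM n) MM. Qed.

(** Each step appends a single pair from the supply with [C = 1]; its functional is within
    [d / n.+1] of some [f k] with [n <= k]. *)
Lemma not_schur_wc0star (R : realType) (X : normedModType R) (e : R) :
  0 < e -> ~ schur_property (dual X) ->
  exists (x : nat -> X) (xs : nat -> dual X),
    wc0star_biorthogonal x xs /\ M_bounded (1 + e) x xs.
Proof.
move=> e0 /not_schur_supply[f [S [fS Slin f0 supS _]]].
(* For [d <= 1] the product [(1 + d) ^+ 2] is at most [1 + 3 * d]. *)
pose d := Num.min 1 (e / 3).
have d0 : 0 < d by rewrite lt_min ltr01 divr_gt0.
have d1 : d <= 1 by rewrite ge_min lexx.
have de : d <= e / 3 by rewrite ge_min lexx orbT.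
pose I (s : seq (X * dual X)) := biorth s /\ forall p, p \in s -> S p.2.
have d0' : 0 <= d by exact: ltW.
have A0 : 0 <= 1 + d by rewrite addr_ge0.
have I0 : I [::] by [].
have Ib s : I s -> biorth s by case.
have [n s [bs Ss]|x [xs [wc bM _]]] := @limit_system R X I (fun _ _ => True) f
    1 d (1 + d) (1 + d) ler01 d0' A0 A0 f0 I0 Ib; last first.
  by exists x, xs; split=> //; apply: M_boundedW bM; move: d0 d1 de; nra.
have dn0 : 0 < d / n.+1%:R by rewrite divr_gt0.
have dnd : d / n.+1%:R <= d by rewrite ler_pdivrMr// ler_peMr ?ler1n// ltW.
have [p [k [nk bps Sp pC pf]]] := good_pair n fS Slin supS ler01 dn0 bs Ss.
exists [:: p]; split=> //.
  split; first by rewrite biorth_catC.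
  by move=> q; rewrite mem_cat inE => /orP[/Ss|/eqP ->].
move=> q; rewrite inE => /eqP ->; split.
+ by rewrite (le_trans pC)// lerD2l.
+ rewrite -[p.2](subrK (f k)) addrC (le_trans (ler_normD _ _))// lerD//.
    exact: (fS k).1.
  exact: le_trans dnd.
+ move=> F b Fb; rewrite -[p.2](subrK (f k)) linearD /=.
  apply: le_trans (ler_normD _ _) _; have := Fb k nk.
  have : `|F (p.2 - f k)| <= d / n.+1%:R * `|F|.
    by apply: le_trans (dual_le _ _) _; rewrite mulrC ler_wpM2r.
  have : 0 <= d / n.+1%:R * `|F| by rewrite mulr_ge0// ltW.
  move: (_ * `|F|) => y; lra.
Qed.

(** * Haar mixing *)

Section HaarSplitting.
Variables (R : realType) (X : normedModType R).
Implicit Types (s t : seq (X * dual X)) (p q : X * dual X).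

Let r2 : R := Num.sqrt 2.
Let kappa : R := 1 + r2.

Let r2_gt0 : 0 < r2. Proof. by rewrite sqrtr_gt0. Qed.

Let r2r2 : r2^-1 * r2^-1 = 2^-1.
Proof. by rewrite -invfM -expr2 sqr_sqrtr. Qed.

(** The two-by-two Haar matrix is symmetric and orthogonal, hence its own inverse: a mixed element
    stays in the span of its two images. *)
Let haar_sum (V : lmodType R) (v w : V) :
  v = r2^-1 *: (r2^-1 *: (v + w) + r2^-1 *: (v - w)).
Proof.
rewrite -scalerDr [v + w + _]addrACA subrr addr0 scalerA r2r2 -mulr2n.
by rewrite -[v *+ 2]scaler_nat scalerA mulVf ?scale1r.
Qed.

(* [kappa = (kappa + 1) / sqrt 2], so an excess over [kappa * B] is divided by
   [sqrt 2] when a contribution bounded by [B] is averaged in. *)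
Let excess_halving (a b B e : R) : a <= kappa * B + e -> b <= B ->
  r2^-1 * (a + b) <= kappa * B + e / r2.
Proof.
move=> aB bB; rewrite ler_pdivrMl// mulrDr (mulrC r2 (e / r2)) divfK ?gt_eqF//.
have -> : r2 * (kappa * B) = kappa * B + B.
  have -> : r2 * (kappa * B) = r2 * B + r2 ^+ 2 * B by rewrite /kappa; ring.
  by rewrite sqr_sqrtr// /kappa; ring.
lra.
Qed.

Definition haar_plus p q : X * dual X :=
  (r2^-1 *: (p.1 + q.1), r2^-1 *: (p.2 + q.2)).
Definition haar_minus p q : X * dual X :=
  (r2^-1 *: (p.1 - q.1), r2^-1 *: (p.2 - q.2)).

(** The same orthogonal matrix acts on vectors and on functionals, which preserves
    biorthogonality. *)
Lemma biorth_haar s p q : biorth (q :: p :: s) ->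
  biorth (haar_plus p q :: haar_minus p q :: s).
Proof.
move=> b; have bp : biorth (p :: s) by move: b; rewrite biorth_cons => /and3P[].
have bs : biorth s by move: bp; rewrite biorth_cons => /and3P[].
have qq := biorth_norm b (mem_head _ _); have pp := biorth_norm bp (mem_head _ _).
have [qp pq] := biorth_orth b (mem_head _ _).
have qs v : v \in s -> q.2 v.1 = 0 /\ v.2 q.1 = 0.
  by move=> vs; apply: (biorth_orth b); rewrite inE vs orbT.
have ps v : v \in s -> p.2 v.1 = 0 /\ v.2 p.1 = 0 by exact: biorth_orth.
rewrite !biorth_cons bs andbT /=.
have E1 (g h : dual X) y : (r2^-1 *: (g + h)) y = r2^-1 * (g y + h y) by [].
have E2 (g h : dual X) y : (r2^-1 *: (g - h)) y = r2^-1 * (g y - h y) by [].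
have E3 (g : dual X) y z : g (r2^-1 *: (y + z)) = r2^-1 * (g y + g z).
  by rewrite linearZ linearD.
have E4 (g : dual X) y z : g (r2^-1 *: (y - z)) = r2^-1 * (g y - g z).
  by rewrite linearZ linearB.
have n1 : normalized (haar_plus p q).
  rewrite /normalized [_.2]/= [_.1]/= E1 !E3 pp pq qp qq.
  by rewrite addr0 add0r mulr1 mulrDr r2r2; apply/eqP; field.
have n2 : normalized (haar_minus p q).
  rewrite /normalized [_.2]/= [_.1]/= E2 !E4 pp pq qp qq.
  by rewrite subr0 sub0r mulr1 mulrN1 opprK mulrDr r2r2; apply/eqP; field.
have o12 : orthogonal (haar_plus p q) (haar_minus p q).
  rewrite /orthogonal [_.2]/= [_.1]/= E1 !E4 [_.2]/= [_.1]/= E2 !E3 pp pq qp qq.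
  by apply/andP; split; apply/eqP; ring.
have o v : v \in s -> orthogonal (haar_plus p q) v && orthogonal (haar_minus p q) v.
  move=> vs; have [qv vq] := qs v vs; have [pv vp] := ps v vs.
  rewrite /orthogonal ![(haar_plus _ _).2]/= ![(haar_minus _ _).2]/=.
  rewrite ![(haar_plus _ _).1]/= ![(haar_minus _ _).1]/= E1 E2 E3 E4 qv vq pv vp.
  by rewrite addr0 subr0 mulr0 eqxx.
rewrite n1 n2 o12 /=.
by apply/andP; split; apply/allP => v /o /andP[].
Qed.

Variables (f : nat -> dual X) (K : nat) (d : R).

(** [e] is the excess over [kappa] times the bounds [2 + d], [1 + d] and [b + d * |F|] of a new
    pair. Kept additive, it lets [excess_halving] treat the three clauses alike. *)
Definition controlled (e : R) p :=
  [/\ `|p.1| <= kappa * (2 + d) + e, `|p.2| <= kappa * (1 + d) + e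
    & forall (F : dual (dual X)) b, (forall k, (K <= k)%N -> `|F (f k)| <= b) ->
        `|F p.2| <= kappa * (b + d * `|F|) + e * `|F|].

(* [t] is the image of [p] and [2 ^ N - 1] new pairs under the Haar matrix, applied
   one level at a time. *)
Lemma haar_split N e s p :
  (forall k, `|f k| <= 1) -> supply f setT 2 -> 0 < d ->
  biorth (p :: s) -> controlled e p ->
  exists t, [/\ t <> [::], biorth (t ++ s),
    forall q, q \in t -> controlled (e / r2 ^+ N) q,
    lin_span (vectors t) p.1 & lin_span (functionals t) p.2].
Proof.
move=> f1 sup d0; elim: N e s p => [|N IH] e s p bps pc.
  exists [:: p]; split=> //.
  - by move=> q; rewrite inE expr0 divr1 => /eqP ->.
  - by apply: lin_span_incl; exact: mem_head.
  - by apply: lin_span_incl; exact: mem_head.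
have [||||q [k [Kk bq _ qC qf]]] :=
  @good_pair _ _ f setT 2 d (p :: s) K _ _ sup _ d0 bps => //.
have q1 : `|q.2| <= 1 + d.
  by rewrite -[q.2](subrK (f k)) addrC (le_trans (ler_normD _ _))// lerD.
have qF (F : dual (dual X)) b : (forall k, (K <= k)%N -> `|F (f k)| <= b) ->
    `|F q.2| <= b + d * `|F|.
  move=> Fb; rewrite -[q.2](subrK (f k)) linearD addrC /=.
  apply: le_trans (ler_normD _ _) _; rewrite lerD ?Fb//.
  by apply: le_trans (dual_le _ _) _; rewrite mulrC ler_wpM2r.
have nZ (V : normedModType R) (v : V) : `|r2^-1 *: v| = r2^-1 * `|v|.
  by rewrite normrZ gtr0_norm// invr_gt0.
have r2i : 0 <= r2^-1 by rewrite invr_ge0 ltW.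
have [pc1 pc2 pc3] := pc.
have c1 : controlled (e / r2) (haar_plus p q).
  split=> [||F b Fb].
  - rewrite nZ; apply: le_trans (excess_halving pc1 qC).
    by rewrite ler_wpM2l// ler_normD.
  - rewrite nZ; apply: le_trans (excess_halving pc2 q1).
    by rewrite ler_wpM2l// ler_normD.
  - rewrite mulrAC linearZ linearD nZ.
    apply: le_trans (excess_halving (pc3 F b Fb) (qF F b Fb)).
    by rewrite ler_wpM2l// ler_normD.
have c2 : controlled (e / r2) (haar_minus p q).
  split=> [||F b Fb].
  - rewrite nZ; apply: le_trans (excess_halving pc1 qC).
    by rewrite ler_wpM2l// ler_normB.
  - rewrite nZ; apply: le_trans (excess_halving pc2 q1).
    by rewrite ler_wpM2l// ler_normB.
  - rewrite mulrAC linearZ linearB nZ.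
    apply: le_trans (excess_halving (pc3 F b Fb) (qF F b Fb)).
    by rewrite ler_wpM2l// ler_normB.
(* [haar_minus p q] belongs to the ambient system while [haar_plus p q] is split; it is then split
   in turn against [s ++ t1]. *)
have [t1 [t10 b1 ct1 v1 h1]] := IH _ _ _ (biorth_haar bq) c1.
have b1' : biorth (haar_minus p q :: (s ++ t1)).
  by rewrite -cat_cons biorth_catC.
have [t2 [t20 b2 ct2 v2 h2]] := IH _ _ _ b1' c2.
exists (t1 ++ t2); split.
- by case: (t1) t10.
- by rewrite -catA biorth_catC -catA.
- move=> v; rewrite exprS invfM mulrA mem_cat => /orP[/ct1//|/ct2//].
- rewrite (haar_sum p.1 q.1).
  apply: lin_spanZ; apply: lin_spanD.
    by apply: lin_spanS v1; rewrite vectors_cat; exact: subsetUl.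
  by apply: lin_spanS v2; rewrite vectors_cat; exact: subsetUr.
- rewrite (haar_sum p.2 q.2).
  apply: lin_spanZ; apply: lin_spanD.
    by apply: lin_spanS h1; rewrite functionals_cat; exact: subsetUl.
  by apply: lin_spanS h2; rewrite functionals_cat; exact: subsetUr.
Qed.

End HaarSplitting.

(** * Absorbing given vectors and functionals *)

Section Absorption.
Variables (R : realType) (X : normedModType R).
Implicit Types (s t : seq (X * dual X)) (p : X * dual X).

(** The residual of [x] is paired with a functional norming it. When it vanishes, [x] is already
    absorbed and the extension given by hypothesis is used, so that a pair is always adjoined. *)
Lemma absorb_vector s (x : X) : (exists p, biorth (p :: s)) -> biorth s ->
  exists p, biorth (p :: s) /\ lin_span (vectors (p :: s)) x.
Proof.
move=> [p bps] bs.
have sub q : lin_span (vectors (q :: s)) (x - res s x).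
  by apply: lin_spanS (res_span s x) => y /= ys; rewrite /vectors /= inE ys orbT.
have [r0|r0] := eqVneq (res s x) 0.
  by exists p; split=> //; have := sub p; rewrite r0 subr0.
have [f [_ fr]] := hahn_banach_norming (res s x).
exists (res s (`|res s x|^-1 *: x), cores s f); split.
  apply: biorth_extend => //; rewrite resZ.
  have -> : f (`|res s x|^-1 *: res s x) = `|res s x|^-1 * f (res s x).
    by rewrite linearZ.
  by rewrite fr mulVf ?normr_eq0.
set q := (_, _).
have -> : x = (x - res s x) + `|res s x| *: q.1.
  by rewrite /q /= resZ scalerA divff ?normr_eq0// scale1r subrK.
apply: lin_spanD; first exact: sub.
by apply: lin_spanZ; apply: lin_span_incl; exact: mem_head.
Qed.

(** Here a point where the residual functional is nonzero replaces the Hahn-Banach theorem. *)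
Lemma absorb_functional s (g : dual X) : (exists p, biorth (p :: s)) -> biorth s ->
  exists p, biorth (p :: s) /\ lin_span (functionals (p :: s)) g.
Proof.
move=> [p bps] bs.
have sub q : lin_span (functionals (q :: s)) (g - cores s g).
  by apply: lin_spanS (cores_span s g) => y /= ys;
    rewrite /functionals /= inE ys orbT.
have [[x gx]|gx] := pselect (exists x, cores s g x != 0); last first.
  exists p; split=> //; have := sub p.
  suff -> : cores s g = 0 by rewrite subr0.
  apply: val_inj; apply/funext => x; apply/eqP/negPn/negP => x0.
  by apply: gx; exists x.
exists (res s ((cores s g x)^-1 *: x), cores s g); split.
  apply: biorth_extend => //; rewrite -cores_res.
  have -> : cores s g ((cores s g x)^-1 *: x) = (cores s g x)^-1 * cores s g x.
    by rewrite linearZ.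
  exact: mulVf.
set q := (_, _).
have -> : g = (g - cores s g) + q.2 by rewrite subrK.
apply: lin_spanD; first exact: sub.
by apply: lin_span_incl; exact: mem_head.
Qed.

(** A biorthogonal system with functionals in the span of [S] is grown until its vectors span [ps].
    Then [g - cores s g] lies in the span of [S] and agrees with [g] on [ps]. *)
Lemma span_interpolation (S : set (dual X)) (ps : seq X) (g : dual X) :
  (forall x, x != 0 -> exists2 h, S h & h x != 0) ->
  exists2 h, lin_span S h & forall x, x \in ps -> h x = g x.
Proof.
move=> sep.
suff [s [bs Ss sx]] : exists s, [/\ biorth s, forall p, p \in s -> lin_span S p.2
    & forall x, x \in ps -> res s x = 0].
  exists (g - cores s g); last first.
    move=> x /sx rx; have -> : (g - cores s g) x = g x - cores s g x by [].
    by rewrite cores_res rx linear0 subr0.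
  by apply: lin_span_trans (cores_span s g) => h /= /mapP[p /Ss Sp ->].
elim: ps => [|x ps [s [bs Ss sx]]]; first by exists [::].
have [r0|/sep[h Sh hr]] := eqVneq (res s x) 0.
  by exists s; split=> // y; rewrite inE => /orP[/eqP ->|/sx].
pose q := (res s ((h (res s x))^-1 *: x), cores s h).
have bq : biorth (q :: s).
  apply: biorth_extend => //; rewrite resZ linearZ; exact: mulVf.
exists (q :: s); split=> //.
  move=> p; rewrite inE => /orP[/eqP ->|/Ss//].
  rewrite -[q.2](subKr h); apply: lin_spanB; first exact: lin_span_incl.
  by apply: lin_span_trans (cores_span s h) => k /= /mapP[p' /Ss Sp ->].
have resE y : res (q :: s) y = res s y - q.2 y *: q.1.
  by rewrite /res big_cons opprD addrA addrAC.
move=> y; rewrite inE resE => /orP[/eqP ->|ys]; last first.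
  have -> : q.2 y = cores s h y by [].
  by rewrite cores_res sx// linear0 scale0r subr0.
have -> : q.2 x = h (res s x) by exact: cores_res.
by rewrite [q.1]resZ scalerA divff// scale1r subrr.
Qed.

Lemma separating_total (xs : nat -> dual X) :
  (forall x, x != 0 -> exists2 h, lin_span (range xs) h & h x != 0) ->
  total_system xs.
Proof.
move=> sep; rewrite /total_system; apply/seteqP; split=> // g _.
have interp (ps : seq X) : exists2 h, lin_span (range xs) h &
    forall x, x \in ps -> h x = g x.
  have [h Sh hg] := span_interpolation ps g sep.
  by exists h => //; apply: lin_span_trans Sh => k Sk; exact: Sk.
(* The interpolants of [g] on finite lists of points generate a filter that converges pointwise to
   [g]. *)
pose B (ps : seq X) := [set h : dual X | lin_span (range xs) h /\
  forall x, x \in ps -> h x = g x].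
pose G : set_system (dual X) := filter_from setT B.
have FG : Filter G.
  apply: filter_from_filter; first by exists [::].
  move=> ps qs _ _; exists (ps ++ qs) => // h [Sh hg].
  by split; split=> // x xp; apply: hg; rewrite mem_cat xp ?orbT.
have cvg_ev : {ptws, ((@dual_fun R X) @ G) --> (g : X -> R)}.
  apply/pointwise_cvgP => x A /nbhs_singleton Ax.
  by exists [:: x] => // h [_ hg] /=; rewrite hg ?mem_head.
move=> A [_ [[V oV <-] Vg VA]].
have [ps _ psV] : G ((@dual_fun R X) @^-1` V).
  by apply: cvg_ev; exact: open_nbhs_nbhs.
have [h Sh hg] := interp ps.
by exists h; split=> //; apply: VA; apply: psV.
Qed.

End Absorption.

(** * Dense sequences and norming sequences of functionals *)

Section Norming.
Variables (R : realType) (X : normedModType R).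

Lemma separable_dense_sequence : separable X ->
  exists v : nat -> X, forall x e, 0 < e -> exists n, `|x - v n| <= e.
Proof.
move=> [D [/countable_injP[i iD] denseD]].
have H n : exists y, forall x, D x -> i x = n -> y = x.
  have [[y [Dy <-]]|nH] := pselect (exists y, D y /\ i y = n).
    by exists y => x Dx /esym xy; apply: iD; rewrite ?inE.
  (* [0] fills the indices that code no point of [D]. *)
  by exists 0 => x Dx xn; exfalso; apply: nH; exists x.
exists (fun n => projT1 (cid (H n))) => x e e0.
have [||y [xy Dy]] := denseD (ball x e).
- by exists x; exact: ballxx.
- exact: ball_open.
exists (i y); case: cid => z /= /(_ y Dy erefl) ->.
by move: xy; rewrite -ball_normE => /ltW.
Qed.

Variables (v : nat -> X) (g : nat -> dual X).
Hypothesis v_dense : forall x e, 0 < e -> exists n, `|x - v n| <= e.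
Hypothesis g_norming : forall n, `|g n| <= 1 /\ g n (v n) = `|v n|.

Lemma norming_approx x e : 0 < e -> exists n, `|x| - e <= g n x.
Proof.
move=> e0; have e2 : 0 < e / 2 by rewrite divr_gt0.
have [n xn] := v_dense x e2; exists n; have [g1 gv] := g_norming n.
have : `|g n (x - v n)| <= e / 2.
  apply: le_trans (dual_le _ _) _; apply: le_trans xn.
  by rewrite -[leRHS]mul1r ler_wpM2r.
rewrite linearB /= gv ler_norml => /andP[+ _].
have : `|x| <= `|x - v n| + `|v n| by rewrite -{1}(subrK (v n) x) ler_normD.
move: xn; lra.
Qed.

Lemma norming_separating x : x != 0 -> exists n, 0 < g n x.
Proof.
rewrite -normr_gt0 => x0; have x2 : 0 < `|x| / 2 by rewrite divr_gt0.
by have [n xn] := norming_approx x x2; exists n; move: xn; lra.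
Qed.

Lemma norming_norms (Z : set (dual X)) : (forall n, Z (g n)) -> norms Z.
Proof.
move=> Zg x; rewrite mul1r; set S := [set _ | _ in _].
have Sub : has_ubound S.
  exists `|x| => _ [z [_ /eqP z0] <-].
  rewrite ler_pdivrMr ?normr_gt0// mulrC.
  by apply: le_trans (ler_norm _) (dual_le _ _).
have [x0|x0] := eqVneq x 0.
  (* At [x = 0] every quotient is 0, and the supremum of the empty set is 0 as well. *)
  rewrite x0 normr0; have [[b Sb]|nS] := pselect (S !=set0).
    apply: le_trans (ub_le_sup Sub Sb); case: Sb => z _ <-.
    by rewrite x0 linear0 mul0r.
  rewrite (_ : S = set0) ?sup0//.
  by apply/seteqP; split=> // b Sb; apply: nS; exists b.
(* The cap [|x| / 2] makes [g n x] positive, so [g n] is nonzero and dividing by [|g n| <= 1] cannot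
   decrease the value. *)
apply/ler_addgt0Pr => e e0; pose e' := Num.min e (`|x| / 2).
have nx : 0 < `|x| by rewrite normr_gt0.
have e'0 : 0 < e' by rewrite lt_min e0 divr_gt0.
have [n xn] := norming_approx x e'0.
have e'e : e' <= e by rewrite ge_min lexx.
have e'x : e' <= `|x| / 2 by rewrite ge_min lexx orbT.
have gx0 : 0 < g n x by lra.
have gn0 : g n != 0 by apply: contraTneq gx0 => ->; rewrite ltxx.
have : g n x / `|g n| <= sup S.
  by apply: (ub_le_sup Sub); exists (g n) => //; split=> //; exact/eqP.
have : g n x <= g n x / `|g n|.
  by rewrite ler_pdivlMr ?normr_gt0// ler_piMr ?(ltW gx0)//; exact: (g_norming n).1.
lra.
Qed.

End Norming.

(** * Bounded fundamental total systems *)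

Section FundamentalTotal.
Variables (R : realType) (X : normedModType R).
Implicit Types (s t : seq (X * dual X)) (p q : X * dual X).

Let kappa : R := 1 + Num.sqrt 2.

(** Every pair is controlled with excess [|p.1| + |p.2|], however large; enough Haar levels bring
    the excess down to [d]. *)
Lemma haar_block (f : nat -> dual X) n (d : R) s p :
  (forall k, `|f k| <= 1) -> supply f setT 2 -> 0 < d -> biorth (p :: s) ->
  exists t, [/\ t <> [::], biorth (s ++ t),
    forall q, q \in t -> [/\ `|q.1| <= kappa * (2 + d) + d,
      `|q.2| <= kappa * (1 + d) + d & near_tail kappa f n d q.2],
    lin_span (vectors t) p.1 & lin_span (functionals t) p.2].
Proof.
move=> f1 sup d0 bps; pose e := `|p.1| + `|p.2|.
have k0 : 0 <= kappa by rewrite addr_ge0// sqrtr_ge0.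
have pc : controlled f n d e p.
  have pos c : 0 <= c -> 0 <= kappa * (c + d).
    by move=> c0; rewrite mulr_ge0// addr_ge0// ltW.
  split=> [||F b Fb].
  - by rewrite ler_wpDl ?pos// lerDl.
  - by rewrite ler_wpDl ?pos// lerDr.
  - have b0 : 0 <= b by apply: le_trans (Fb n (leqnn n)).
    rewrite ler_wpDl ?mulr_ge0 ?addr_ge0 ?mulr_ge0 ?(ltW d0)//.
    by apply: le_trans (dual_le _ _) _; rewrite mulrC ler_wpM2r// lerDr.
have [N eN] : exists N, e / Num.sqrt 2 ^+ N <= d.
  have [m em] : exists m : nat, e / d <= m%:R.
    exists (Num.bound (e / d)); apply/ltW/archi_boundP.
    by rewrite divr_ge0 ?addr_ge0// ltW.
  (* [2 * m] levels divide the excess by [2 ^ m], which exceeds [m >= e / d]. *)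
  exists (2 * m)%N; rewrite exprM sqr_sqrtr// ler_pdivrMr ?exprn_gt0//.
  rewrite -ler_pdivrMl// mulrC (le_trans em)// -natrX ler_nat.
  by rewrite ltnW// ltn_expl.
have [t [t0 bt ct vt ht]] := haar_split N f1 sup d0 bps pc.
exists t; split=> //; first by rewrite biorth_catC.
move=> q /ct[q1 q2 q3]; split.
- by rewrite (le_trans q1)// lerD2l.
- by rewrite (le_trans q2)// lerD2l.
- by move=> F b /q3 /le_trans; apply; rewrite lerD2l ler_wpM2r.
Qed.

Lemma not_schur_fundamental_total (e : R) :
  0 < e -> separable X -> ~ schur_property (dual X) ->
  exists (x : nat -> X) (xs : nat -> dual X),
    [/\ wc0star_biorthogonal x xs, M_bounded (2 * kappa ^+ 2 + e) x xs,
        fundamental_system x, total_system xs & norms (closed_span (range xs))].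
Proof.
move=> e0 /separable_dense_sequence[v v_dense].
move=> /not_schur_supply[f [S [fS _ f0 _ sup]]].
have f1 k : `|f k| <= 1 := (fS k).1.
pose g n := projT1 (cid (hahn_banach_norming (v n))).
have g_norming n : `|g n| <= 1 /\ g n (v n) = `|v n| by rewrite /g; case: cid.
have k1 : 1 <= kappa by rewrite lerDl sqrtr_ge0.
have k0 : 0 <= kappa by exact: le_trans k1.
(* As [d ^+ 2 <= d], the product of the two norm bounds exceeds [2 * kappa ^+ 2] by at most
   [d * ((kappa + 1) * (4 * kappa + 1))]. *)
pose d := Num.min 1 (e / ((kappa + 1) * (4 * kappa + 1))).
have den0 : 0 < (kappa + 1) * (4 * kappa + 1).
  by rewrite mulr_gt0// ltr_wpDl// mulr_ge0.
have d0 : 0 < d by rewrite lt_min ltr01 divr_gt0.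
have d1 : d <= 1 by rewrite ge_min lexx.
have de : d * ((kappa + 1) * (4 * kappa + 1)) <= e.
  by rewrite -ler_pdivlMr// ge_min lexx orbT.
have d0' : 0 <= d by exact: ltW.
have AB (c : R) : 0 <= c -> 0 <= kappa * (c + d) + d.
  by move=> c0; rewrite addr_ge0// mulr_ge0// addr_ge0.
pose Q n s := lin_span (vectors s) (v n) /\ lin_span (functionals s) (g n).
have ext s : biorth s -> exists p, biorth (p :: s).
  move=> bs; have fT k : `|f k| <= 1 /\ setT (f k) by [].
  have [//|//|p [k [_ bp _ _ _]]] := good_pair 0 fT _ sup (ler0n _ 2) ltr01 bs.
  by exists p.
have [n s bs|x [xs [wc bM Qx]]] := @limit_system R X (@biorth R X) Q f kappa d
    (kappa * (2 + d) + d) (kappa * (1 + d) + d) k0 d0' (AB _ (ler0n _ 2)) (AB _ ler01)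
    f0 erefl (fun _ => id).
  have dn0 : 0 < d / n.+1%:R by rewrite divr_gt0.
  have dnd : d / n.+1%:R <= d by rewrite ler_pdivrMr// ler_peMr ?ler1n.
  have weaken t : (forall q, q \in t ->
      [/\ `|q.1| <= kappa * (2 + d / n.+1%:R) + d / n.+1%:R,
       `|q.2| <= kappa * (1 + d / n.+1%:R) + d / n.+1%:R &
       near_tail kappa f n (d / n.+1%:R) q.2]) ->
     forall q, q \in t -> [/\ `|q.1| <= kappa * (2 + d) + d,
       `|q.2| <= kappa * (1 + d) + d & near_tail kappa f n (d / n.+1%:R) q.2].
    move=> H q /H[q1 q2 q3]; split=> //.
      by rewrite (le_trans q1)// lerD// ler_wpM2l// lerD2l.
    by rewrite (le_trans q2)// lerD// ler_wpM2l// lerD2l.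
  (* Step [n] absorbs [v n] and splits the adjoined pair, then absorbs [g n] and splits again; the
     spans of the Haar blocks keep what was absorbed. *)
  have [p [bp vp]] := absorb_vector (v n) (ext s bs) bs.
  have [t [t0 bst tQ vt _]] := haar_block n f1 sup dn0 bp.
  have [p' [bp' gp']] := absorb_functional (g n) (ext _ bst) bst.
  have [t' [t'0 bst' tQ' _ gt']] := haar_block n f1 sup dn0 bp'.
  exists (t ++ t'); rewrite catA; split=> //.
  - by case: (t) t0.
  - split.
      rewrite vectors_cat; apply: lin_spanS (@subsetUl _ _ _) _ _.
      apply: lin_span_trans vp => y; rewrite {1}/vectors /= inE => /orP[/eqP ->|ys].
        by apply: lin_spanS vt; rewrite vectors_cat; exact: subsetUr.
      by apply: lin_span_incl; rewrite vectors_cat; left.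
    apply: lin_span_trans gp' => y.
    rewrite {1}/functionals /= inE => /orP[/eqP ->|ys].
      by apply: lin_spanS gt'; rewrite functionals_cat; exact: subsetUr.
    by apply: lin_span_incl; rewrite functionals_cat; left.
  - by move=> q; rewrite mem_cat => /orP[|]; exact: weaken.
have vspan n : lin_span (range x) (v n).
  have [m [+ _]] := Qx n; apply: lin_spanS => y /=.
  by rewrite /vectors /= /unzip1 -map_comp => /mapP[i _ ->]; exists i.
have gspan n : lin_span (range xs) (g n).
  have [m [_]] := Qx n; apply: lin_spanS => y /=.
  by rewrite /functionals /= /unzip2 -map_comp => /mapP[i _ ->]; exists i.
exists x, xs; split=> //.
- apply: M_boundedW bM; apply: (le_trans _ (lerD (lexx _) de)).
  have -> : (kappa * (2 + d) + d) * (kappa * (1 + d) + d) = 2 * kappa ^+ 2 +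
      d * ((kappa + 1) * (4 * kappa + 1)) - (kappa + 1) ^+ 2 * (d * (1 - d)).
    by rewrite -/kappa; ring.
  by rewrite lerBlDr lerDl mulr_ge0// ?sqr_ge0// mulr_ge0// subr_ge0.
- apply/seteqP; split=> // y _ A /nbhs_normP[r r0 rA].
  have r2 : 0 < r / 2 by rewrite divr_gt0.
  have [n yn] := v_dense y _ r2; exists (v n); split=> //; apply: rA => /=.
  by apply: le_lt_trans yn _; rewrite ltr_pdivrMr// ltr_pMr// ltr1n.
- apply: separating_total => y /(norming_separating v_dense g_norming)[n gy].
  by exists (g n) => //; rewrite gt_eqF.
- apply: (norming_norms v_dense g_norming) => n.
  by apply: subset_closure.
Qed.

End FundamentalTotal.

Theorem theorem1 (R : realType) (X : completeNormedModType R)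
    (X_infdim : infinite_dimensional X) :
  let a := ~ schur_property (dual X) in
  let b := exists (x : nat -> X) (xs : nat -> dual X),
    wc0star_biorthogonal x xs /\ bounded_system x xs in
  let c := exists (x : nat -> X) (xs : nat -> dual X),
    [/\ wc0star_biorthogonal x xs, bounded_system x xs,
        fundamental_system x & total_system xs] in
  [/\ a <-> b,
      separable X -> (a <-> c) /\ (b <-> c),
      forall eps : R, 0 < eps -> b ->
        exists (x : nat -> X) (xs : nat -> dual X),
          wc0star_biorthogonal x xs /\ M_bounded (1 + eps) x xs
    & forall eps : R, 0 < eps -> separable X -> c ->
        exists (x : nat -> X) (xs : nat -> dual X),
          [/\ wc0star_biorthogonal x xs,
              M_bounded (2 * (1 + Num.sqrt 2) ^+ 2 + eps) x xs,
              fundamental_system x, total_system xs & norms (closed_span (range xs))]].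
Proof.
move=> a b c.
have ba : b -> a by move=> [x [xs [wc _]]]; exact: wc0star_not_schur wc.
have ab : a -> b.
  move=> /(not_schur_wc0star ltr01)[x [xs [wc bM]]].
  by exists x, xs; split=> //; eexists; exact: bM.
have ca : c -> a by move=> [x [xs [wc _ _ _]]]; exact: wc0star_not_schur wc.
have ac : separable X -> a -> c.
  move=> sX /(not_schur_fundamental_total ltr01 sX)[x [xs [wc bM fund tot _]]].
  by exists x, xs; split=> //; eexists; exact: bM.
split.
- by split.
- move=> sX; split; split; [exact: ac|exact: ca| |by move=> /ca/ab].
  by move=> /ba; exact: ac.
- by move=> e e0 /ba; exact: not_schur_wc0star.
- by move=> e e0 sX /ca; exact: not_schur_fundamental_total.
Qed.
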